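(* Let $\triangle ABC$ be a (nondegenerate) triangle in the Euclidean plane, and let $T$ be its Morley trisector triangle, that is, the triangle $\triangle DEF$ whose vertices are the three points of intersection of adjacent interior angle trisectors of $\triangle ABC$. Then $T$ is equilateral: $|DE|=|EF|=|FD|$.
   Context: Write the interior angles of $\triangle ABC$ at $A,B,C$ as $3\alpha,3\beta,3\gamma$ respectively, so that $\alpha,\beta,\gamma>0$ and $\alpha+\beta+\gamma=60^\circ$. Each interior angle is divided into three equal angles by two rays (its trisectors) from the corresponding vertex. For each side of $\triangle ABC$, take the trisector nearest to that side at each of its two endpoints; these two rays meet at a point inside $\triangle ABC$. The Morley trisector triangle $T$ is the triangle formed by the three points so obtained. Explicitly, $D,E,F$ are the points inside $\triangle ABC$ with $\angle DBC=\beta,\ \angle DCB=\gamma$; $\ \angle ECA=\gamma,\ \angle EAC=\alpha$; $\ \angle FAB=\alpha,\ \angle FBA=\beta$. *)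

(* Defs.v *)
From Stdlib Require Import Reals.
Open Scope R_scope.

(* The Euclidean plane, in Cartesian coordinates. *)
Definition point : Type := (R * R)%type.

Definition distance (P Q : point) : R :=
  dist_euc (fst P) (snd P) (fst Q) (snd Q).

Definition dot (u v : R * R) : R := fst u * fst v + snd u * snd v.

Definition vec (P Q : point) : R * R := (fst Q - fst P, snd Q - snd P).

(* The unoriented angle PQS, with vertex Q, in radians and in [0, PI].  It is
   meaningful only for P <> Q and S <> Q. *)
Definition angle (P Q S : point) : R :=
  acos (dot (vec Q P) (vec Q S) / (distance Q P * distance Q S)).

Definition collinear (P Q S : point) : Prop :=
  exists a b c : R, (a <> 0 \/ b <> 0) /\
    a * fst P + b * snd P = c /\
    a * fst Q + b * snd Q = c /\
    a * fst S + b * snd S = c.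

Definition nondegenerate (A B C : point) : Prop := ~ collinear A B C.

(* The open triangle: points with positive barycentric coordinates. *)
Definition inside (A B C P : point) : Prop :=
  exists u v w : R, 0 < u /\ 0 < v /\ 0 < w /\ u + v + w = 1 /\
    fst P = u * fst A + v * fst B + w * fst C /\
    snd P = u * snd A + v * snd B + w * snd C.

(* The interior angles of ABC at A, B, C are 3 alpha, 3 beta, 3 gamma, and D,
   E, F are the points inside ABC where the trisectors nearest to BC, CA, AB
   respectively meet. *)
Definition morley_triangle (A B C : point) (alpha beta gamma : R)
    (D E F : point) : Prop :=
  (angle B A C = 3 * alpha /\ angle A B C = 3 * beta /\
   angle A C B = 3 * gamma) /\
  (inside A B C D /\ angle D B C = beta /\ angle D C B = gamma) /\
  (inside A B C E /\ angle E C A = gamma /\ angle E A C = alpha) /\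
  (inside A B C F /\ angle F A B = alpha /\ angle F B A = beta).

Definition equilateral (D E F : point) : Prop :=
  distance D E = distance E F /\ distance E F = distance F D.

(* Main.v *)
(** Along [AB], the ray [AF] is turned by [alpha] and [AE] by [2 alpha], so
    the angle [EAF] is [alpha]. The law of sines in [AFB] and
    [sin 3x = 4 sin x sin (60° + x) sin (60° - x)] give
    [AF = 4k sin beta sin gamma sin (60° + gamma)], and likewise
    [AE = 4k sin beta sin gamma sin (60° + beta)], where [k] is the
    circumdiameter of [ABC]. Since [60° + beta], [60° + gamma] and [alpha] add up
    to [180°], the law of cosines yields
    [EF = 4k sin alpha sin beta sin gamma], which is symmetric. *)

Require Import Defs.
From Stdlib Require Import Reals Lra Lia Psatz.
Open Scope R_scope.

(** * Oriented angles between plane vectors *)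

Definition cross (u v : R * R) : R := fst u * snd v - snd u * fst v.

Definition norm (u : R * R) : R := sqrt (dot u u).

(* [v] points in the direction of [u] turned by the oriented angle [t], where
   the sign [s] (either [1] or [-1]) selects the positive orientation. *)
Definition rotated (s t : R) (u v : R * R) : Prop :=
  dot u v = norm u * norm v * cos t /\ s * cross u v = norm u * norm v * sin t.

Lemma norm_ge0 u : 0 <= norm u.
Proof. apply sqrt_pos. Qed.

Lemma norm_sqr u : norm u * norm u = dot u u.
Proof. apply sqrt_sqrt; unfold dot; nra. Qed.

Lemma distance_norm P Q : distance P Q = norm (vec P Q).
Proof.
unfold distance, dist_euc, norm, dot, vec, Rsqr; simpl; f_equal; ring.
Qed.

Lemma norm_vec_sym P Q : norm (vec P Q) = norm (vec Q P).
Proof. unfold norm, dot, vec; simpl; f_equal; ring. Qed.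

Lemma angle_sym P Q S : angle P Q S = angle S Q P.
Proof.
unfold angle; f_equal; f_equal; [unfold dot; ring | apply Rmult_comm].
Qed.

Lemma lagrange_identity u v :
  dot u v * dot u v + cross u v * cross u v = dot u u * dot v v.
Proof. unfold dot, cross; ring. Qed.

Lemma cross_neq0_norm_gt0 u v : cross u v <> 0 -> 0 < norm u /\ 0 < norm v.
Proof.
intros h.
assert (hl := lagrange_identity u v).
rewrite <- !norm_sqr in hl.
assert (hu := norm_ge0 u); assert (hv := norm_ge0 v).
assert (0 < cross u v * cross u v) by nra.
split.
- destruct (Req_dec (norm u) 0) as [e | e]; [rewrite e in hl; nra | lra].
- destruct (Req_dec (norm v) 0) as [e | e]; [rewrite e in hl; nra | lra].
Qed.

(** The cosine is read off from [acos]. By Lagrange's identity the sine is then right up to sign,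
    and both candidates are nonnegative: [s] makes the cross product positive and [acos] takes
    values in [[0, PI]]. *)
Lemma angle_rotated s P Q S :
  s * s = 1 -> 0 < s * cross (vec Q P) (vec Q S) ->
  rotated s (angle P Q S) (vec Q P) (vec Q S).
Proof.
intros hs hc.
unfold angle; rewrite !distance_norm.
set (u := vec Q P) in *; set (v := vec Q S) in *.
assert (hne : cross u v <> 0) by (intros e; rewrite e in hc; lra).
destruct (cross_neq0_norm_gt0 u v hne) as [hu hv].
assert (hl := lagrange_identity u v); rewrite <- !norm_sqr in hl.
set (n := norm u * norm v).
assert (hn : 0 < n) by (unfold n; nra).
set (x := dot u v / n).
assert (hx : dot u v = n * x) by (unfold x; field; lra).
assert (hx1 : n * n * (x * x) + (s * cross u v) * (s * cross u v) = n * n).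
{ replace (s * cross u v * (s * cross u v))
    with ((s * s) * (cross u v * cross u v)) by ring.
  rewrite hs.
  transitivity (dot u v * dot u v + cross u v * cross u v);
    [rewrite hx; ring | rewrite hl; unfold n; ring]. }
assert (hb : -1 <= x <= 1).
{ assert (x * x <= 1) by (apply Rmult_le_reg_l with (n * n); nra).
  nra. }
assert (hcos := cos_acos x hb).
assert (hsin : 0 <= sin (acos x)) by (destruct (acos_bound x); apply sin_ge_0; lra).
assert (h1 := sin2_cos2 (acos x)); unfold Rsqr in h1; rewrite hcos in h1.
split.
- fold n; rewrite hcos; exact hx.
- fold n; apply Rsqr_inj; [lra | nra | unfold Rsqr; nra].
Qed.

Lemma rotated_flip s t u v : rotated s t u v -> rotated (- s) t v u.
Proof.
intros [h1 h2]; split.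
- replace (dot v u) with (dot u v) by (unfold dot; ring); rewrite h1; ring.
- replace (- s * cross v u) with (s * cross u v) by (unfold cross; ring).
  rewrite h2; ring.
Qed.

Lemma rotated_inv s t u v : rotated s t u v -> rotated s (- t) v u.
Proof.
intros [h1 h2]; split; [rewrite cos_neg | rewrite sin_neg].
- replace (dot v u) with (dot u v) by (unfold dot; ring); rewrite h1; ring.
- replace (s * cross v u) with (- (s * cross u v)) by (unfold cross; ring).
  rewrite h2; ring.
Qed.

Lemma rotated_vec_opp s t P Q S T :
  rotated s t (vec P Q) (vec S T) -> rotated s t (vec Q P) (vec T S).
Proof.
unfold rotated; rewrite (norm_vec_sym Q P), (norm_vec_sym T S).
intros [h1 h2]; split.
- rewrite <- h1; unfold dot, vec; simpl; ring.
- rewrite <- h2; unfold cross, vec; simpl; ring.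
Qed.

(** With vectors as complex numbers, [dot u v] and [cross u v] are the real and imaginary parts of
    [conj u * v], and the product of [conj u * v] and [conj v * w] is [conj u * w] times the square
    of [norm v]. *)
Lemma rotated_trans s a b u v w :
  s * s = 1 -> 0 < norm v ->
  rotated s a u v -> rotated s b v w -> rotated s (a + b) u w.
Proof.
intros hs hv [h1 h2] [h3 h4].
assert (hvv := norm_sqr v).
assert (hv2 : norm v * norm v <> 0) by nra.
split; apply Rmult_eq_reg_l with (norm v * norm v); trivial.
- rewrite cos_plus.
  transitivity (dot u v * dot v w - (s * cross u v) * (s * cross v w)).
  + replace (s * cross u v * (s * cross v w))
      with ((s * s) * (cross u v * cross v w)) by ring.
    rewrite hs, hvv; unfold dot, cross; ring.
  + rewrite h1, h2, h3, h4; ring.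
- rewrite sin_plus.
  transitivity ((s * cross u v) * dot v w + dot u v * (s * cross v w)).
  + rewrite hvv; unfold dot, cross; ring.
  + rewrite h1, h2, h3, h4; ring.
Qed.

(** * Trisector lengths and one side of the Morley triangle *)

Lemma law_of_sines_apex s a b A B F :
  0 < norm (vec A B) ->
  rotated s a (vec A B) (vec A F) -> rotated s b (vec B F) (vec B A) ->
  norm (vec A F) * sin (a + b) = norm (vec A B) * sin b.
Proof.
intros hc [h1 h2] [h3 h4].
assert (hcc := norm_sqr (vec A B)).
rewrite (norm_vec_sym B A) in h3, h4.
(* The projections of [AF] and [BF] onto [AB] add up to [AB], and both segments have the same height
   over it. Eliminating [BF] gives the law of sines without the angle at [F]. *)
assert (hd : dot (vec A B) (vec A F) + dot (vec B F) (vec B A)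
             = dot (vec A B) (vec A B)) by (unfold dot, vec; simpl; ring).
assert (hx : s * cross (vec A B) (vec A F) = s * cross (vec B F) (vec B A))
  by (unfold cross, vec; simpl; ring).
rewrite h1, h3, <- hcc in hd; rewrite h2, h4 in hx.
rewrite sin_plus.
apply Rmult_eq_reg_l with (norm (vec A B)); [| lra].
replace (norm (vec A B) * (norm (vec A B) * sin b))
  with (norm (vec A B) * norm (vec A B) * sin b) by ring.
rewrite <- hd.
transitivity ((norm (vec A B) * norm (vec A F) * sin a) * cos b
              + norm (vec A B) * norm (vec A F) * cos a * sin b); [ring |].
rewrite hx; ring.
Qed.

Lemma sin_triple_product x :
  sin (3 * x) = 4 * sin x * sin (PI / 3 + x) * sin (PI / 3 - x).
Proof.
replace (3 * x) with (x + 2 * x) by ring.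
rewrite sin_plus, sin_2a, cos_2a, sin_plus, sin_minus, sin_PI3, cos_PI3.
assert (h3 : sqrt 3 * sqrt 3 = 3) by (apply sqrt_sqrt; lra).
assert (h1 := sin2_cos2 x); unfold Rsqr in h1.
replace (4 * sin x * (sqrt 3 / 2 * cos x + 1 / 2 * sin x)
           * (sqrt 3 / 2 * cos x - 1 / 2 * sin x))
  with (sin x * ((sqrt 3 * sqrt 3) * (cos x * cos x) - sin x * sin x)) by field.
rewrite h3; ring.
Qed.

(** The factor [sin (PI / 3 - c)] of [sin (3 * c)] is [sin (a + b)], which cancels in the law of
    sines for [AFB]. *)
Lemma trisector_length s k a b c A B F :
  0 < a -> 0 < b -> 0 < c -> a + b + c = PI / 3 ->
  0 < norm (vec A B) -> norm (vec A B) = k * sin (3 * c) ->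
  rotated s a (vec A B) (vec A F) -> rotated s b (vec B F) (vec B A) ->
  norm (vec A F) = 4 * k * sin b * sin c * sin (PI / 3 + c).
Proof.
intros ha hb hc hsum hAB hk h1 h2.
assert (h := law_of_sines_apex s a b A B F hAB h1 h2).
rewrite hk, sin_triple_product in h.
replace (PI / 3 - c) with (a + b) in h by lra.
assert (0 < sin (a + b)) by (assert (hPI := PI_RGT_0); apply sin_gt_0; lra).
apply Rmult_eq_reg_r with (sin (a + b)); [rewrite h; ring | lra].
Qed.

(* The law of cosines in a triangle of circumdiameter 1 with angles [x], [y]
   and [PI - (x + y)]. *)
Lemma sin_plus_sqr x y :
  sin x * sin x + sin y * sin y + 2 * sin x * sin y * cos (x + y)
  = sin (x + y) * sin (x + y).
Proof.
rewrite sin_plus, cos_plus.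
assert (hx := sin2_cos2 x); assert (hy := sin2_cos2 y); unfold Rsqr in *.
(* Each square is multiplied by 1, written as the squared sine plus squared cosine of the other
   angle, so that both sides agree as polynomials. *)
replace (sin x * sin x) with (sin x * sin x * (sin y * sin y + cos y * cos y))
  by (rewrite hy; ring).
replace (sin y * sin y)
  with (sin y * sin y * (sin x * sin x + cos x * cos x)) at 2
  by (rewrite hx; ring).
ring.
Qed.

Lemma morley_side s k a b c A B C E F :
  s * s = 1 -> 0 < k ->
  0 < a -> 0 < b -> 0 < c -> a + b + c = PI / 3 ->
  0 < norm (vec A B) -> norm (vec A B) = k * sin (3 * c) ->
  0 < norm (vec A C) -> norm (vec A C) = k * sin (3 * b) ->
  rotated s (3 * a) (vec A B) (vec A C) ->
  rotated s a (vec A B) (vec A F) -> rotated s b (vec B F) (vec B A) ->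
  rotated s a (vec A E) (vec A C) -> rotated s c (vec C A) (vec C E) ->
  distance E F = 4 * k * sin a * sin b * sin c.
Proof.
intros hs hk ha hb hc hsum hAB hABk hAC hACk hA hAF hBF hAE hCE.
assert (hf := trisector_length s k a b c A B F ha hb hc hsum hAB hABk hAF hBF).
assert (he : norm (vec A E) = 4 * k * sin c * sin b * sin (PI / 3 + b)).
(* Seen from side [AC] the configuration is mirrored: [s] changes sign and [b], [c] swap. *)
{ apply (trisector_length (- s) k a c b A C E); try lra;
    apply rotated_flip; assumption. }
assert (hdot : dot (vec A F) (vec A E) = norm (vec A F) * norm (vec A E) * cos a).
{ replace a with (- a + (3 * a + - a)) by ring.
  apply (rotated_trans s _ _ _ (vec A B)); trivial.
  - apply rotated_inv; assumption.
  - apply (rotated_trans s _ _ _ (vec A C)); trivial.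
    apply rotated_inv; assumption. }
assert (hPI := PI_RGT_0).
assert (0 < sin a) by (apply sin_gt_0; lra).
assert (0 < sin b) by (apply sin_gt_0; lra).
assert (0 < sin c) by (apply sin_gt_0; lra).
rewrite distance_norm.
apply Rsqr_inj.
- apply norm_ge0.
- repeat apply Rmult_le_pos; lra.
- unfold Rsqr; rewrite norm_sqr.
  transitivity (norm (vec A E) * norm (vec A E) + norm (vec A F) * norm (vec A F)
                - 2 * dot (vec A F) (vec A E)).
  { rewrite !norm_sqr; unfold dot, vec; simpl; ring. }
  rewrite hdot, he, hf.
  assert (hs2 := sin_plus_sqr (PI / 3 + c) (PI / 3 + b)).
  replace (PI / 3 + c + (PI / 3 + b)) with (PI - a) in hs2 by lra.
  rewrite sin_PI_x, (Rtrigo_facts.cos_pi_minus a) in hs2.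
  transitivity ((4 * k * sin b * sin c) * (4 * k * sin b * sin c)
                * (sin a * sin a)); [rewrite <- hs2; ring | ring].
Qed.

(** * Orientation of the triangle and its interior points *)

Lemma nondegenerate_cross A B C :
  nondegenerate A B C -> cross (vec A B) (vec A C) <> 0.
Proof.
destruct A as [x y], B as [x' y'], C as [x'' y''].
unfold cross, vec; simpl; intros hnd h0; apply hnd.
unfold collinear; simpl.
(* The witness is the line [AB] if [A] and [B] differ; otherwise a line through [A] and [C],
   vertical when their abscissas agree. *)
destruct (Req_dec x x') as [ex | ex]; [destruct (Req_dec y y') as [ey | ey] |].
- subst; destruct (Req_dec x' x'') as [ex | ex].
  + subst; exists 1, 0, x''; repeat split; lra.
  + exists (y'' - y'), (x' - x''), ((y'' - y') * x' + (x' - x'') * y').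
    repeat split; lra.
- exists (y' - y), (x - x'), ((y' - y) * x + (x - x') * y); repeat split; lra.
- exists (y' - y), (x - x'), ((y' - y) * x + (x - x') * y); repeat split; lra.
Qed.

Lemma cross_cycle A B C :
  cross (vec B C) (vec B A) = cross (vec A B) (vec A C).
Proof. unfold cross, vec; simpl; ring. Qed.

Lemma inside_cycle A B C P : inside A B C P -> inside B C A P.
Proof.
intros (u & v & w & hu & hv & hw & h1 & hx & hy).
exists v, w, u; repeat split; lra.
Qed.

Lemma inside_cross s A B C P :
  0 < s * cross (vec A B) (vec A C) -> inside A B C P ->
  0 < s * cross (vec A B) (vec A P) /\ 0 < s * cross (vec B P) (vec B A).
Proof.
intros hs (u & v & w & hu & hv & hw & h1 & hx & hy).
(* The barycentric coordinate [w] is the ratio of the signed areas of [ABP] and [ABC]. *)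
assert (h : s * cross (vec A B) (vec A P) = w * (s * cross (vec A B) (vec A C))).
{ unfold cross, vec; simpl; rewrite hx, hy.
  replace u with (1 - v - w) by lra; ring. }
replace (cross (vec B P) (vec B A)) with (cross (vec A B) (vec A P))
  by (unfold cross, vec; simpl; ring).
rewrite h; split; apply Rmult_lt_0_compat; assumption.
Qed.

Lemma inside_rotated s A B C P :
  s * s = 1 -> 0 < s * cross (vec A B) (vec A C) -> inside A B C P ->
  rotated s (angle P A B) (vec A B) (vec A P) /\
  rotated s (angle P B A) (vec B P) (vec B A).
Proof.
intros hs hc hP.
destruct (inside_cross s A B C P hc hP).
split; [rewrite angle_sym |]; apply angle_rotated; assumption.
Qed.

(** * Interior angles: bounds, sum and law of sines *)

Lemma rotated_sin_gt0 s t u v :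
  0 < s * cross u v -> rotated s t u v -> 0 < sin t.
Proof.
intros hc [_ h].
assert (hne : cross u v <> 0) by (intros e; rewrite e in hc; lra).
destruct (cross_neq0_norm_gt0 u v hne).
rewrite h in hc.
apply Rmult_lt_reg_l with (norm u * norm v); [nra | lra].
Qed.

Lemma angle_open_bounds s P Q S :
  s * s = 1 -> 0 < s * cross (vec Q P) (vec Q S) -> 0 < angle P Q S < PI.
Proof.
intros hs hc.
assert (h := rotated_sin_gt0 _ _ _ _ hc (angle_rotated s P Q S hs hc)).
assert (hb : 0 <= angle P Q S <= PI) by apply acos_bound.
split.
- destruct (Req_dec (angle P Q S) 0) as [e | e]; [| lra].
  rewrite e, sin_0 in h; lra.
- destruct (Req_dec (angle P Q S) PI) as [e | e]; [| lra].
  rewrite e, sin_PI in h; lra.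
Qed.

(** Rotations fix the angle sum only modulo [2 * PI]; the bound [3 * PI] on three angles below [PI]
    removes the ambiguity. *)
Lemma cos_eq_opp1 x : 0 < x < 3 * PI -> cos x = -1 -> x = PI.
Proof.
intros hx hcos.
assert (h1 := sin2_cos2 x); unfold Rsqr in h1; rewrite hcos in h1.
assert (hsin : sin x = 0) by nra.
destruct (sin_eq_0_0 x hsin) as [k hk].
assert (hPI := PI_RGT_0).
assert (h0 : 0 < IZR k) by (apply Rmult_lt_reg_r with PI; lra).
assert (h3 : IZR k < 3) by (apply Rmult_lt_reg_r with PI; lra).
apply lt_IZR in h0; apply lt_IZR in h3.
assert (hk12 : (k = 1 \/ k = 2)%Z) by lia.
destruct hk12; subst k; [lra |].
rewrite hk, cos_2PI in hcos; lra.
Qed.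

(** The turns from [AB] to [AC], from [AC] to [BC] and from [BC] to [BA] compose to a half-turn. *)
Lemma rotated_angle_sum s a b c A B C :
  s * s = 1 ->
  0 < norm (vec A B) -> 0 < norm (vec A C) -> 0 < norm (vec B C) ->
  0 < a < PI -> 0 < b < PI -> 0 < c < PI ->
  rotated s a (vec A B) (vec A C) -> rotated s b (vec B C) (vec B A) ->
  rotated s c (vec C A) (vec C B) -> a + c + b = PI.
Proof.
intros hs hAB hAC hBC ha hb hc hA hB hC.
apply rotated_vec_opp in hC.
destruct (rotated_trans _ _ _ _ _ _ hs hBC
            (rotated_trans _ _ _ _ _ _ hs hAC hA hC) hB) as [h _].
rewrite (norm_vec_sym B A) in h.
apply cos_eq_opp1; [lra |].
assert (hn := norm_sqr (vec A B)).
replace (dot (vec A B) (vec B A)) with (- dot (vec A B) (vec A B)) in h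
  by (unfold dot, vec; simpl; ring).
rewrite <- hn in h.
apply Rmult_eq_reg_l with (norm (vec A B) * norm (vec A B)); [lra | nra].
Qed.

Lemma law_of_sines s a b A B C :
  0 < norm (vec A B) ->
  rotated s a (vec A B) (vec A C) -> rotated s b (vec B C) (vec B A) ->
  norm (vec A C) * sin a = norm (vec B C) * sin b.
Proof.
intros hAB [_ h1] [_ h2].
rewrite cross_cycle, h1, (norm_vec_sym B A) in h2.
apply Rmult_eq_reg_l with (norm (vec A B)); lra.
Qed.

Theorem mainTheorem1 :
  forall (A B C : point) (alpha beta gamma : R) (D E F : point),
    nondegenerate A B C ->
    morley_triangle A B C alpha beta gamma D E F ->
    equilateral D E F.
Proof.
intros A B C a b c D E F hnd
  ((hA & hB & hC) & (hD & hD1 & hD2) & (hE & hE1 & hE2) & (hF & hF1 & hF2)).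
assert (hne := nondegenerate_cross A B C hnd).
destruct (cross_neq0_norm_gt0 _ _ hne) as [nAB nAC].
(* The sign [s] is the orientation of [ABC], so one argument covers both orientations. *)
assert (hs : exists s, s * s = 1 /\ 0 < s * cross (vec A B) (vec A C)).
{ destruct (Rlt_le_dec 0 (cross (vec A B) (vec A C)));
    [exists 1 | exists (-1)]; split; lra. }
destruct hs as (s & hs & cA).
assert (cB : 0 < s * cross (vec B C) (vec B A)) by (rewrite cross_cycle; exact cA).
assert (cC : 0 < s * cross (vec C A) (vec C B)) by (rewrite cross_cycle; exact cB).
assert (nBC : 0 < norm (vec B C)).
{ apply (cross_neq0_norm_gt0 _ (vec B A)); rewrite cross_cycle; exact hne. }
assert (bA := angle_open_bounds s B A C hs cA).
assert (bB := angle_open_bounds s C B A hs cB).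
assert (bC := angle_open_bounds s A C B hs cC).
assert (rA := angle_rotated s B A C hs cA).
assert (rB := angle_rotated s C B A hs cB).
assert (rC := angle_rotated s A C B hs cC).
rewrite (angle_sym C B A) in *.
rewrite hA in *; rewrite hB in *; rewrite hC in *.
assert (hsum := rotated_angle_sum s _ _ _ A B C hs nAB nAC nBC bA bB bC rA rB rC).
destruct (inside_rotated s A B C F hs cA hF) as [rF1 rF2].
destruct (inside_rotated s B C A D hs cB (inside_cycle _ _ _ _ hD)) as [rD1 rD2].
destruct (inside_rotated s C A B E hs cC
            (inside_cycle _ _ _ _ (inside_cycle _ _ _ _ hE))) as [rE1 rE2].
rewrite hF1 in rF1; rewrite hF2 in rF2; rewrite hD1 in rD1; rewrite hD2 in rD2;
  rewrite hE1 in rE1; rewrite hE2 in rE2.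
assert (sA := rotated_sin_gt0 _ _ _ _ cA rA).
assert (l1 := law_of_sines s _ _ A B C nAB rA rB).
assert (l2 := law_of_sines s _ _ B C A nBC rB rC).
(* The circumdiameter of [ABC], the common ratio in the law of sines. *)
set (k := norm (vec B C) / sin (3 * a)).
assert (hk : 0 < k) by (apply Rdiv_lt_0_compat; assumption).
assert (kBC : norm (vec B C) = k * sin (3 * a)) by (unfold k; field; lra).
assert (kAC : norm (vec A C) = k * sin (3 * b)).
{ apply Rmult_eq_reg_r with (sin (3 * a)); [rewrite l1, kBC; ring | lra]. }
assert (kAB : norm (vec A B) = k * sin (3 * c)).
{ assert (sB := rotated_sin_gt0 _ _ _ _ cB rB).
  apply Rmult_eq_reg_r with (sin (3 * b)); [| lra].
  rewrite (norm_vec_sym A B), l2, (norm_vec_sym C A), kAC; ring. }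
assert (EF : distance E F = 4 * k * sin a * sin b * sin c).
{ apply (morley_side s k a b c A B C); trivial; lra. }
(* The other two sides follow by cyclic relabelling of the vertices. *)
assert (FD : distance F D = 4 * k * sin b * sin c * sin a).
{ apply (morley_side s k b c a B C A); trivial;
    try rewrite (norm_vec_sym B A); lra. }
assert (DE : distance D E = 4 * k * sin c * sin a * sin b).
{ apply (morley_side s k c a b C A B); trivial;
    try rewrite (norm_vec_sym C A); try rewrite (norm_vec_sym C B); lra. }
split; [rewrite DE, EF | rewrite EF, FD]; ring.
Qed.
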